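(* Let $\phi$ be a polynomial map of height $0$ defined over $\mathbb{Q}$. Then the portrait of preperiodic points for $\phi$ (excluding the point at infinity) is one of the following 14 directed graphs, where $x \to y$ denotes an arrow from $x$ to $y$, each vertex has exactly one outgoing arrow, and distinct letters denote distinct vertices: 1. $a \to a$. 2. $a \to a$, $b \to b$. 3. $a \to b$, $b \to b$. 4. $a \to b$, $b \to a$. 5. $a \to a$, $b \to b$, $c \to c$. 6. $a \to a$, $b \to c$, $c \to b$. 7. $a \to b$, $b \to b$, $c \to c$. 8. $a \to b$, $b \to c$, $c \to c$. 9. $a \to b$, $b \to c$, $c \to b$. 10. $a \to c$, $b \to c$, $c \to c$. 11. $a \to b$, $b \to b$, $c \to e$, $e \to e$. 12. $a \to b$, $b \to b$, $c \to c$, $e \to e$. 13. $a \to b$, $b \to c$, $c \to e$, $e \to c$. 14. $a \to b$, $b \to c$, $c \to b$, $e \to c$. Conversely, each of these 14 directed graphs is realized as the portrait of preperiodic points (excluding the point at infinity) of some polynomial map of height $0$ defined over $\mathbb{Q}$.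
   Context: A polynomial map defined over $\mathbb{Q}$ is a rational map $\phi = (f_0 : f_1) \colon \mathbb{P}^1 \to \mathbb{P}^1$ of degree $d \geq 2$, given by homogeneous polynomials $f_0, f_1 \in \mathbb{Q}[X_0,X_1]$ of degree $d$ without common zero in $\mathbb{P}^1(\overline{\mathbb{Q}})$, for which one can take $f_1 = X_1^d$. Writing $f_0 = \sum_{j=0}^d a_j X_0^{d-j}X_1^j$ and $f_1 = X_1^d$, the height of $\phi$ is $h(\phi) = h((a_0 : \dots : a_d : 1))$, where $h$ is the logarithmic height on projective space over $\mathbb{Q}$: for coprime integers $x_0, \dots, x_N$, $h((x_0 : \dots : x_N)) = \log\max\{|x_0|, \dots, |x_N|\}$. The degree $d \ge 2$ is arbitrary. A point $P \in \mathbb{P}^1(\mathbb{Q})$ is preperiodic for $\phi$ if there exist integers $n \geq 0$ and $m \geq 1$ such that $\phi^{n+m}(P) = \phi^n(P)$, where $\phi^k$ denotes the $k$-th iterate. The point at infinity is $(1:0)$, which is fixed by every polynomial map; the other points of $\mathbb{P}^1(\mathbb{Q})$ are identified with rational numbers $\alpha$ via $\alpha \leftrightarrow (\alpha:1)$. The portrait of preperiodic points for $\phi$, excluding the point at infinity, is the directed graph whose vertices are the rational numbers that are preperiodic for $\phi$, with exactly one arrow out of each vertex $\alpha$, going from $\alpha$ to $\phi(\alpha)$. Portraits are considered up to isomorphism of directed graphs.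
   Formalization: The first claim is proved for maps with at least one rational preperiodic point other than infinity; without this it is false: x^2+1 has height 0 and an empty portrait, which is not among the 14 graphs. *)

(* Defs.v *)
From HB Require Import structures.
From mathcomp Require Import all_boot all_order all_algebra all_field.
From mathcomp Require Import ring reals exp.

Set Implicit Arguments.
Unset Strict Implicit.
Unset Printing Implicit Defensive.

Import Order.TTheory GRing.Theory Num.Theory.
Local Open Scope ring_scope.

(* P^N(Q) is the set of lines of Q^{N+1}; [pt x0] is the point with homogeneous
   coordinates x, for x0 : x != 0 *)
Definition proj (N : nat) : Type :=
  {L : {vspace 'rV[rat]_N.+1} | \dim L == 1}.

Lemma dim_line (N : nat) (x : 'rV[rat]_N.+1) : x != 0 -> \dim <[x]>%VS == 1%N.
Proof. by rewrite dim_vline => ->. Qed.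

Definition pt (N : nat) (x : 'rV[rat]_N.+1) (x0 : x != 0) : proj N :=
  exist _ <[x]>%VS (dim_line x0).

Definition coords (N : nat) (P : proj N) : 'rV[rat]_N.+1 := vpick (sval P).

Lemma coords_neq0 (N : nat) (P : proj N) : coords P != 0.
Proof. by case: P => L /= dL; rewrite vpick0 -dimv_eq0 (eqP dL). Qed.

Lemma eq_pt (N : nat) (x y : 'rV[rat]_N.+1) (x0 : x != 0) (y0 : y != 0) :
  pt x0 = pt y0 <-> exists2 l : rat, l != 0 & x = l *: y.
Proof.
split=> [/(congr1 sval) /= exy | [l l0 exy]].
  have /vlineP[l xE] : x \in <[y]>%VS by rewrite -exy memv_line.
  by exists l => //; apply: contraNneq x0 => l0; rewrite xE l0 scale0r.
apply: val_inj => /=; apply/eqP.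
by rewrite eqEdim !dim_vline x0 y0 leqnn andbT -memvE exy memvZ ?memv_line.
Qed.

Lemma pt_coords (N : nat) (P : proj N) : pt (coords_neq0 P) = P.
Proof.
apply: val_inj => /=; apply/eqP; rewrite eqEdim dim_vline coords_neq0.
by rewrite -memvE memv_pick (eqP (valP P)).
Qed.

(* Coprime integer homogeneous coordinates: clear the denominators, then
   divide by the gcd; [log_height_coprime] states that the height may be
   computed from any coprime integer coordinates. *)
Definition integral_coords (N : nat) (x : 'rV[rat]_N.+1) : 'rV[int]_N.+1 :=
  \row_i numq (x ord0 i * (\prod_j denq (x ord0 j))%:~R).

Definition content (N : nat) (z : 'rV[int]_N.+1) : nat :=
  (\big[gcdn/0]_i `|z ord0 i|)%N.

Definition primitive_coords (N : nat) (x : 'rV[rat]_N.+1) : 'rV[int]_N.+1 :=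
  \row_i (integral_coords x ord0 i %/ content (integral_coords x))%Z.

Definition log_height (R : realType) (N : nat) (P : proj N) : R :=
  ln (\max_i `|primitive_coords (coords P) ord0 i|)%N%:R.

Lemma integral_coordsE (N : nat) (x : 'rV[rat]_N.+1) :
  map_mx intr (integral_coords x) = (\prod_j denq (x ord0 j))%:~R *: x.
Proof.
apply/rowP => i; rewrite !mxE [RHS]mulrC.
suff [n ->] : exists n : int, x ord0 i * (\prod_j denq (x ord0 j))%:~R = n%:~R.
  by rewrite numq_int.
exists (numq (x ord0 i) * \prod_(j | j != i) denq (x ord0 j)).
by rewrite (bigD1 i) //= !intrM mulrA -numqE.
Qed.

Lemma contentZ (N : nat) (a : int) (z : 'rV[int]_N.+1) :
  content (a *: z) = (`|a| * content z)%N.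
Proof.
rewrite /content (big_morph _ (@muln_gcdr `|a|%N) (muln0 _)).
by apply: eq_bigr => i _; rewrite mxE abszM.
Qed.

Lemma content_dvd (N : nat) (z : 'rV[int]_N.+1) i : (content z %| `|z ord0 i|)%N.
Proof. by rewrite /content (bigD1 i) //= dvdn_gcdl. Qed.

Lemma log_height_coprime (R : realType) (N : nat) (z : 'rV[int]_N.+1)
    (z0 : map_mx intr z != 0 :> 'rV[rat]_N.+1) :
  content z = 1%N ->
  log_height R (pt z0) = ln (\max_i `|z ord0 i|)%N%:R.
Proof.
move=> cz; have [l l0 xE] := (eq_pt (coords_neq0 (pt z0)) z0).1 (pt_coords _).
rewrite /log_height; move: (coords _) xE => x xE.
congr (ln _%:R); apply: eq_bigr => i _; rewrite mxE.
have D0 : (\prod_j denq (x ord0 j))%:~R != 0 :> rat.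
  by rewrite intr_eq0; apply/prodf_neq0 => j _; rewrite denq_neq0.
move: (integral_coords x) (integral_coordsE x) D0 => y + D0.
move: (_%:~R) D0 => D D0 yE; pose q := D * l.
have q0 : q != 0 by rewrite mulf_neq0.
have yz : denq q *: y = numq q *: z.
  apply/rowP => j; rewrite !mxE; apply: (@intr_inj rat); rewrite !intrM.
  move/rowP/(_ j): yE; rewrite xE !mxE => ->.
  by rewrite numqE /q mulrA [RHS]mulrAC [RHS]mulrC !mulrA.
have q_gt0 : (0 < `|denq q|)%N by rewrite absz_gt0 denq_neq0.
have cy : (`|denq q| * content y = `|numq q|)%N.
  by rewrite -contentZ yz contentZ cz muln1.
have yi : `|y ord0 i|%N = (content y * `|z ord0 i|)%N.
  have /rowP/(_ i) := yz; rewrite !mxE => /(congr1 absz); rewrite !abszM -cy.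
  by rewrite -mulnA => /eqP; rewrite eqn_pmul2l // => /eqP.
have cy0 : (0 < content y)%N.
  by rewrite lt0n; apply: contraNneq q0 => c0; rewrite -numq_eq0 -absz_eq0 -cy c0 muln0.
have /dvdzP[w wE] : ((content y)%:Z %| y ord0 i)%Z by exact: content_dvd.
have c0 : (content y)%:Z != 0 by rewrite -lt0n.
rewrite wE mulzK //; apply/eqP; rewrite -(eqn_pmul2l cy0) -yi wE abszM.
by rewrite absz_nat mulnC.
Qed.

Definition form (K : fieldType) (d : nat) (a : 'rV[K]_d.+1) (x0 x1 : K) : K :=
  \sum_(j < d.+1) a ord0 j * x0 ^+ (d - j) * x1 ^+ j.

(* phi = (f_0 : f_1) with f_0 = form coef and f_1 = X_1^deg *)
Record polymap := Polymap {
  deg : nat;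
  deg_ge2 : (2 <= deg)%N;
  coef : 'rV[rat]_deg.+1;
  no_common_zero : forall x0 x1 : algC,
    form (map_mx ratr coef) x0 x1 = 0 -> x1 ^+ deg = 0 -> x0 = 0 /\ x1 = 0
}.

Definition row2 (x0 x1 : rat) : 'rV[rat]_2 :=
  \row_(j < 2) (if j == ord0 then x0 else x1).

Definition hom_lift (phi : polymap) (x : 'rV[rat]_2) : 'rV[rat]_2 :=
  row2 (form (coef phi) (x ord0 ord0) (x ord0 ord_max))
       (x ord0 ord_max ^+ deg phi).

Lemma row2_eq0 (x0 x1 : rat) : (row2 x0 x1 == 0) = (x0 == 0) && (x1 == 0).
Proof.
apply/eqP/andP => [/rowP r0 | [/eqP -> /eqP ->]].
  by move: (r0 ord0) (r0 ord_max); rewrite !mxE /= => -> ->.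
by apply/rowP => j; rewrite !mxE if_same.
Qed.

Lemma row2_eta (x : 'rV[rat]_2) : x = row2 (x ord0 ord0) (x ord0 ord_max).
Proof.
apply/rowP => j; rewrite mxE; case: eqP => [-> // | /eqP j0].
congr (x _ _); apply: val_inj => /=.
by case: j j0 => [[|[|]]].
Qed.

Lemma hom_lift_neq0 (phi : polymap) (x : 'rV[rat]_2) : x != 0 -> hom_lift phi x != 0.
Proof.
apply: contraNN; rewrite row2_eq0 => /andP[/eqP f0 /eqP f1].
have [] := @no_common_zero phi (ratr (x ord0 ord0)) (ratr (x ord0 ord_max)).
- rewrite -[RHS](rmorph0 (ratr : rat -> algC)) -f0 [RHS]rmorph_sum.
  by apply: eq_bigr => j _; rewrite !rmorphM !rmorphXn mxE.
- by rewrite -rmorphXn f1 rmorph0.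
by move=> /eqP + /eqP; rewrite !fmorph_eq0 (row2_eta x) row2_eq0 -row2_eta => -> ->.
Qed.

Definition action (phi : polymap) (P : proj 1) : proj 1 :=
  pt (hom_lift_neq0 phi (coords_neq0 P)).

Lemma hom_liftZ (phi : polymap) (l : rat) (x : 'rV[rat]_2) :
  hom_lift phi (l *: x) = l ^+ deg phi *: hom_lift phi x.
Proof.
apply/rowP => i; rewrite !mxE; case: ifP => _; last exact: exprMn.
rewrite /form mulr_sumr; apply: eq_bigr => j _.
have jd : (j <= deg phi)%N by rewrite -ltnS.
have -> : l ^+ deg phi = l ^+ (deg phi - j) * l ^+ j by rewrite -exprD subnK.
by rewrite !exprMn; ring.
Qed.

Lemma action_pt (phi : polymap) (x : 'rV[rat]_2) (x0 : x != 0) :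
  action phi (pt x0) = pt (hom_lift_neq0 phi x0).
Proof.
have [l l0 xE] := (eq_pt (coords_neq0 (pt x0)) x0).1 (pt_coords _).
apply/eq_pt; exists (l ^+ deg phi); first by rewrite expf_neq0.
by rewrite xE hom_liftZ.
Qed.

(* the homogeneous coordinates (a_0 : ... : a_d : 1) *)
Definition coef1 (phi : polymap) : 'rV[rat]_(deg phi + 1).+1 :=
  row_mx (coef phi) 1%:M.

Lemma coef1_neq0 (phi : polymap) : coef1 phi != 0.
Proof.
have := row_mx_eq0 (coef phi) (1%:M : 'M_1).
by rewrite oner_eq0 andbF => /negbT.
Qed.

Definition height (R : realType) (phi : polymap) : R :=
  log_height R (pt (coef1_neq0 phi)).

Lemma row2_1_neq0 (alpha : rat) : row2 alpha 1 != 0.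
Proof. by rewrite row2_eq0 oner_eq0 andbF. Qed.

Definition affine_pt (alpha : rat) : proj 1 := pt (row2_1_neq0 alpha).

Lemma action_affine (phi : polymap) (alpha : rat) :
  action phi (affine_pt alpha) =
  affine_pt (\sum_(j < (deg phi).+1) coef phi ord0 j * alpha ^+ (deg phi - j)).
Proof.
rewrite action_pt; apply/eq_pt; exists 1; first exact: oner_neq0.
rewrite scale1r /hom_lift !mxE /= expr1n /form.
by congr row2; apply: eq_bigr => j _; rewrite expr1n mulr1.
Qed.

Definition preperiodic (phi : polymap) (P : proj 1) : Prop :=
  exists n m : nat, (1 <= m)%N /\
    iter (n + m) (action phi) P = iter n (action phi) P.

Record digraph := Digraph {
  vertex : Type;
  arrow : vertex -> vertex -> Prop
}.

Definition digraph_iso (G H : digraph) : Prop :=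
  exists f : vertex G -> vertex H,
    bijective f /\ forall x y, arrow x y <-> arrow (f x) (f y).

Definition portrait (phi : polymap) : digraph :=
  {| vertex := {alpha : rat | preperiodic phi (affine_pt alpha)};
     arrow := fun x y =>
       action phi (affine_pt (sval x)) = affine_pt (sval y) |}.

(* the digraph with the given list of arrows, each vertex being the source of
   an arrow *)
Definition digraph_of (s : seq (nat * nat)) : digraph :=
  {| vertex := {x : nat | x \in unzip1 s};
     arrow := fun x y => (sval x, sval y) \in s |}.

Definition portraits : seq (seq (nat * nat)) :=
  let a := 0%N in let b := 1%N in let c := 2%N in let e := 3%N in
  [:: [:: (a, a)];
      [:: (a, a); (b, b)];
      [:: (a, b); (b, b)];
      [:: (a, b); (b, a)];
      [:: (a, a); (b, b); (c, c)];
      [:: (a, a); (b, c); (c, b)];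
      [:: (a, b); (b, b); (c, c)];
      [:: (a, b); (b, c); (c, c)];
      [:: (a, b); (b, c); (c, b)];
      [:: (a, c); (b, c); (c, c)];
      [:: (a, b); (b, b); (c, e); (e, e)];
      [:: (a, b); (b, b); (c, c); (e, e)];
      [:: (a, b); (b, c); (c, e); (e, c)];
      [:: (a, b); (b, c); (c, b); (e, c)]].

(* Main.v *)
Require Import Defs.
From mathcomp Require Import all_boot all_order all_algebra.
From mathcomp Require Import reals.
From mathcomp Require Import algC boolp exp zify ring.

(** Height 0 means that phi is given by an integer polynomial p of degree d
    with coefficients in {-1, 0, 1} and leading coefficient 1 or -1
    ([height0_poly], [poly_polymap]).

    Rational preperiodic points are then integers, because the denominator of
    p(a) is the d-th power of that of a ([denq_horner]); and they lie in
    {-2, ..., 2}, because |p(x)| > |x| for every integer x with |x| >= 3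
    ([unit_height_expands]).  An orbit that leaves {-2, ..., 2} never comes
    back, so the portrait depends only on the table of the values of p on
    {-2, ..., 2}, where every value outside that window is replaced by a
    single symbol ([realizes_iso]).

    It remains to see which tables occur.  If |p(2)| <= 2, the dominant term
    2^d is cancelled by the others, which forces
    p = s (x^d - x^(d-1) - ... - x - 1 + e) with s = 1 or -1 and e = 0 or 1
    ([unit_height_extremal]); the table of such a polynomial depends only on
    s, e, and on d through small values and parity.  The case |p(-2)| <= 2
    follows by conjugation with x -> -x.  In the remaining case neither 2 nor
    -2 is preperiodic, and the only information needed is that p(0) is a
    coefficient and that p(1) and p(-1) have the same parity: this rules out
    the 3-cycle, the one functional graph on at most three vertices that is
    not in the list.  Both the classification of these finitely many tables
    and the realization of the 14 portraits by explicit polynomials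
    ([models]) are then finite computations. *)

Set Implicit Arguments.
Unset Strict Implicit.
Unset Printing Implicit Defensive.
Import Order.TTheory GRing.Theory Num.Theory.
Local Open Scope ring_scope.

(** * Integer polynomials of height 0 *)

(** Integer polynomials of degree d >= 2 with coefficients in {-1, 0, 1}; the
    third clause makes the degree exactly d. *)
Definition unit_height (d : nat) (p : {poly int}) : Prop :=
  [/\ (2 <= d)%N, (size p <= d.+1)%N, `|p`_d| = 1 & forall i, `|p`_i| <= 1].

Lemma horner_recr (R : nzSemiRingType) (d : nat) (p : {poly R}) (x : R) :
  (size p <= d.+1)%N -> p.[x] = \sum_(i < d) p`_i * x ^+ i + p`_d * x ^+ d.
Proof. by move=> sp; rewrite (horner_coef_wide _ sp) big_ord_recr. Qed.

(** The terms of degree < d contribute at most (n^d - 1) / (n - 1) < n^d / 2 in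
    absolute value, where n = |x| >= 3. *)
Lemma unit_height_expands (d : nat) (p : {poly int}) (x : int) :
  unit_height d p -> 3 <= `|x| -> `|x| < `|p.[x]|.
Proof.
move=> [d2 sp pd p1] x3; rewrite (horner_recr _ sp); set S := \sum_(i < d) _.
have S_le : `|S| <= \sum_(i < d) `|x| ^+ i.
  apply: le_trans (ler_norm_sum _ _ _) _; apply: ler_sum => i _.
  by rewrite normrM normrX ler_piMl ?exprn_ge0.
have geo := subrX1 `|x| d.
have T0 : 0 <= \sum_(i < d) `|x| ^+ i by apply: sumr_ge0 => i _; rewrite exprn_ge0.
have xd : `|p`_d * x ^+ d| = `|x| ^+ d by rewrite normrM normrX pd mul1r.
have x2d : `|x| ^+ 2 <= `|x| ^+ d by rewrite ler_weXn2l //; lia.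
have tri : `|x| ^+ d - `|S| <= `|S + p`_d * x ^+ d|.
  by rewrite -xd [S + _]addrC lerB_normD.
move: S_le geo T0 x2d tri; move: (\sum_(i < d) _) => T; move: (`|x| ^+ d) => X.
move: `|S| => S'; rewrite expr2; nia.
Qed.

(** The value at x of s (X^d - X^(d-1) - ... - X - 1 + e). *)
Definition extremal_value (s e : int) (d : nat) (x : int) : int :=
  s * (x ^+ d - \sum_(i < d) x ^+ i + e).

(** With s the leading coefficient, every 1 + s p_i is nonnegative, and the sum
    over i < d of (1 + s p_i) 2^i is s p(2) - 1 <= 1.  Hence 1 + s p_i vanishes
    for 0 < i < d, and e is the remaining term 1 + s p_0. *)
Lemma unit_height_extremal (d : nat) (p : {poly int}) :
  unit_height d p -> `|p.[2]| <= 2 ->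
  exists2 e : int, e \in [:: 0; 1] & forall x, p.[x] = extremal_value p`_d e d x.
Proof.
move=> [d2 sp pd p1] p2; set s := p`_d in pd *.
have s1 : s = 1 \/ s = -1 by move: pd; lia.
have ss : s * s = 1 by case: s1 => ->.
have d_gt0 : (0 < d)%N by lia.
pose c i := 1 + s * p`_i.
have c_ge0 i : 0 <= c i by rewrite /c; move: (p1 i); case: s1 => ->; lia.
have sum_c : \sum_(i < d) c i * 2 ^+ i = s * p.[2] - 1.
  rewrite (horner_recr _ sp) mulrDr mulrA -/s ss mul1r mulr_sumr.
  under eq_bigr do rewrite mulrDl mul1r -mulrA.
  rewrite big_split /=; have := subrX1 (2 : int) d; set T := \sum_(i < d) 2 ^+ i.
  by set X := 2 ^+ d; move: (\sum_(i < d) s * _) => U; lia.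
have le1 : \sum_(i < d) c i * 2 ^+ i <= 1.
  by rewrite sum_c; case: s1 p2 => ->; lia.
have term_le (i : 'I_d) : c i * 2 ^+ i <= 1.
  apply: le_trans le1; rewrite (bigD1 i) //= lerDl; apply: sumr_ge0 => j _.
  by rewrite mulr_ge0 ?exprn_ge0.
have c0 i : (0 < i < d)%N -> c i = 0.
  case/andP => i0 id; have := term_le (Ordinal id); rewrite /= -(prednK i0) exprS.
  have : 1 <= 2 ^+ i.-1 :> int by apply: exprn_ege1.
  by move: (c_ge0 i.-1.+1); nia.
exists (c 0%N).
  by have := term_le (Ordinal d_gt0); rewrite /= expr0 mulr1 !inE; move: (c_ge0 0%N); lia.
move=> x; rewrite (horner_recr _ sp) -/s /extremal_value.
have -> : \sum_(i < d) p`_i * x ^+ i = s * (- \sum_(i < d) x ^+ i + c 0%N); last by ring.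
have -> : c 0%N = \sum_(i < d) c i * x ^+ i.
  case: (d) d_gt0 c0 => // n _ c0; rewrite big_ord_recl big1 ?addr0 ?expr0 ?mulr1 //.
  by move=> i _; rewrite c0 ?mul0r ?ltn_ord.
rewrite addrC -sumrB mulr_sumr; apply: eq_bigr => i _; rewrite /c.
by rewrite mulrBr mulrA mulrDr mulrA ss mulr1 mul1r; ring.
Qed.

Lemma horner_parity (p : {poly int}) : (2 %| p.[-1] - p.[1])%Z.
Proof.
rewrite !horner_coef -sumrB; apply: rpred_sum => i _ /=.
by rewrite -mulrBr expr1n -signr_odd dvdz_mull //; case: odd.
Qed.

(** Writing a = n / q in lowest terms, p(a) = N / q^d with N congruent to
    p_d n^d modulo q, so that N is prime to q. *)
Lemma denq_horner (d : nat) (p : {poly int}) (a : rat) :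
  (0 < d)%N -> (size p <= d.+1)%N -> `|p`_d| = 1 ->
  denq (map_poly intr p).[a] = denq a ^+ d.
Proof.
move=> d0 sp pd; set n := numq a; set q := denq a.
have q0 : q%:~R != 0 :> rat by rewrite intr_eq0 denq_neq0.
pose M := \sum_(i < d) p`_i * n ^+ i * q ^+ (d - i.+1).
have -> : (map_poly intr p).[a] = (q * M + p`_d * n ^+ d)%:~R / (q ^+ d)%:~R.
  rewrite (@horner_recr _ d) ?size_map_inj_poly //; last exact: intr_inj.
  apply: (@mulIf _ (q ^+ d)%:~R); first by rewrite intr_eq0 expf_neq0 ?denq_neq0.
  rewrite divfK ?intr_eq0 ?expf_neq0 ?denq_neq0 // !coef_map_id0 //.
  rewrite [in LHS](_ : a = n%:~R / q%:~R); last by rewrite divq_num_den.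
  rewrite rmorphD !rmorphM /= mulrDl; congr (_ + _).
    rewrite rmorph_sum mulr_suml mulr_sumr; apply: eq_bigr => i _ /=.
    rewrite coef_map_id0 // !rmorphM !rmorphXn /= expr_div_n.
    have -> : q%:~R ^+ d = q%:~R ^+ (d - i.+1) * q%:~R ^+ i * q%:~R :> rat.
      by rewrite -exprD -exprSr -addnS subnK.
    have qi : q%:~R ^+ i != 0 :> rat by rewrite expf_neq0.
    by field.
  by rewrite !rmorphXn /= expr_div_n -mulrA divfK ?expf_neq0.
rewrite coprimeq_den ?expf_eq0 ?(negPf (denq_neq0 _)) ?andbF.
  by rewrite normrX gtr0_norm ?denq_gt0.
rewrite -coprimezE coprimezXr // coprimez_sym /coprimez (mulrC q) gcdzMDl.
rewrite -/(coprimez _ _) coprimezMr coprimezXr ?andbT.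
  rewrite coprimezE; have -> : absz p`_d = 1%N by lia.
  exact: coprimen1.
by rewrite coprimez_sym coprimezE coprime_num_den.
Qed.

(** * Preperiodic points of a self-map *)

(** Preperiodicity for an arbitrary self-map; [preperiodic] is the case of the
    action of phi on the projective line. *)
Definition preper (T : Type) (f : T -> T) (x : T) : Prop :=
  exists n m : nat, (1 <= m)%N /\ iter (n + m) f x = iter n f x.

Lemma preper_of_stable (T : eqType) (f : T -> T) (L : seq T) (x : T) :
  {in L, forall y, f y \in L} -> x \in L -> preper f x.
Proof.
move=> fL xL; have iL n : iter n f x \in L by elim: n => //= n; apply: fL.
have : ~~ uniq (traject f x (size L).+1).
  apply/negP => /uniq_leq_size sz; suff /sz : {subset traject f x (size L).+1 <= L}.
    by rewrite size_traject ltnn.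
  by move=> _ /trajectP[i _ ->].
rewrite looping_uniq negbK => /loopingP/(_ (size L))/trajectP[i iS eS].
by exists i, (size L - i)%N; rewrite subn_gt0 (subnKC (ltnW iS)).
Qed.

Lemma not_preper_of_growth (T : Type) (f : T -> T) (P : T -> Prop) (mu : T -> nat)
    (k : nat) (x : T) :
  (forall y, P y -> P (f y) /\ (mu y < mu (f y))%N) ->
  P (iter k f x) -> ~ preper f x.
Proof.
move=> Pf Pk [n [[|m] [] // _ e]].
have Pn i : P (iter (i + k) f x) by elim: i => // i /Pf[].
have lt_mu i : (mu (iter (n + k) f x) < mu (iter (i.+1 + (n + k)) f x))%N.
  elim: i => [|i IHi]; first exact: (Pf _ (Pn n)).2.
  by apply: ltn_trans IHi _; rewrite !addnA; exact: (Pf _ (Pn (i.+1 + n)%N)).2.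
have := lt_mu m; have -> : (m.+1 + (n + k) = k + (n + m.+1))%N by lia.
by rewrite (iterD k (n + m.+1)) e -iterD addnC ltnn.
Qed.

Lemma preper_inj (S T : Type) (h : S -> T) (f : S -> S) (g : T -> T) (x : S) :
  injective h -> (forall y, g (h y) = h (f y)) -> preper g (h x) <-> preper f x.
Proof.
move=> hI gh; have it n : iter n g (h x) = h (iter n f x) by elim: n => //= n ->.
split=> -[n [m [m0 e]]]; exists n, m; split=> //; last by rewrite !it e.
by apply: hI; rewrite -!it.
Qed.

(** * Portraits from the values on {-2, ..., 2} *)

Lemma affine_pt_inj : injective affine_pt.
Proof.
move=> a b /eq_pt[l l0 /rowP e]; move: (e ord0) (e ord_max).
by rewrite !mxE /= mulr1 => -> <-; rewrite mul1r.
Qed.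

Definition window : seq int := [:: -2; -1; 0; 1; 2].

(** Projection onto the window, all the integers outside it being collapsed to
    the symbol 3. *)
Definition clip (x : int) : int := if x \in window then x else 3.

Definition table (f : int -> int) : seq int := [seq clip (f x) | x <- window].

(** The self-map of {-2, ..., 3} with table t; it fixes the symbol 3, which is
    not in the window, by the default value of [nth]. *)
Definition step (t : seq int) (x : int) : int := nth 3 t (index x window).

(** The points of the window whose orbit under [step t] never reaches 3: an
    orbit that reaches it does so in at most 5 steps, one for each point of the
    window. *)
Definition trapped (t : seq int) : seq int :=
  [seq x <- window | iter 5 (step t) x != 3].

(** The arrows of f on L, each vertex being named by its position in L. *)
Definition arrows (f : int -> int) (L : seq int) : seq (nat * nat) :=
  [seq (i, index (f L`_i) L) | i <- iota 0 (size L)].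

(** Some ordering of the trapped points identifies [step t] with the digraph
    given by s. *)
Definition realizes (t : seq int) (s : seq (nat * nat)) : bool :=
  has (fun L => all (fun x => step t x \in L) L && (arrows (step t) L == s))
      (permutations (trapped t)).

(** If the rational preperiodic points are exactly the integers of L, the
    portrait is the digraph of f on L. *)
Lemma digraph_iso_list (phi : polymap) (f : int -> int) (L : seq int) :
  (forall x : int, action phi (affine_pt x%:~R) = affine_pt (f x)%:~R) ->
  uniq L ->
  (forall a, preperiodic phi (affine_pt a) <-> exists2 x, x \in L & a = x%:~R) ->
  {in L, forall x, f x \in L} ->
  digraph_iso (portrait phi) (digraph_of (arrows f L)).
Proof.
move=> act uL prepL fL.
have unz : unzip1 (arrows f L) = iota 0 (size L).
  by rewrite /arrows /unzip1 -map_comp map_id.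
have numL (v : vertex (portrait phi)) : numq (sval v) \in L.
  by have [x xL ->] := (prepL _).1 (svalP v); rewrite numq_int.
have numK (v : vertex (portrait phi)) : (numq (sval v))%:~R = sval v.
  by have [x xL ->] := (prepL _).1 (svalP v); rewrite numq_int.
have val_eq (v w : vertex (portrait phi)) : sval v = sval w -> v = w.
  case: v w => [a pa] [b pb] /= e; case: _ / e pb => pb.
  by rewrite (Prop_irrelevance pa pb).
have to_in (v : vertex (portrait phi)) :
    index (numq (sval v)) L \in unzip1 (arrows f L).
  by rewrite unz mem_iota index_mem numL.
have ltL (w : vertex (digraph_of (arrows f L))) : (sval w < size L)%N.
  by case: w => i /= iL; move: iL; rewrite unz mem_iota.
have from_in (w : vertex (digraph_of (arrows f L))) :
    preperiodic phi (affine_pt (L`_(sval w))%:~R).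
  apply/prepL; exists L`_(sval w) => //; apply/mem_nth/ltL.
exists (fun v => exist (fun i => i \in unzip1 (arrows f L)) _ (to_in v)); split.
  exists (fun w => exist (fun a => preperiodic phi (affine_pt a)) _ (from_in w)) => [v | w].
    by apply: val_eq; rewrite /= nth_index ?numL // numK.
  apply: val_inj; rewrite /= numq_int index_uniq // ltL.
move=> v w; rewrite /= -(numK v) act -(numK w) !numq_int.
split=> [/affine_pt_inj/intr_inj <- | ].
  apply/mapP; exists (index (numq (sval v)) L); last by rewrite nth_index.
  by rewrite mem_iota index_mem numL.
case/mapP => i _ [<-]; rewrite nth_index // => e; congr (affine_pt _%:~R).
by rewrite -(nth_index 0 (numL w)) e nth_index // fL.
Qed.

Lemma mem_window (x : int) : (x \in window) = (`|x| <= 2).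
Proof. by rewrite !inE; lia. Qed.

Lemma clip_id (x : int) : x \in window -> clip x = x.
Proof. by rewrite /clip => ->. Qed.

Lemma clip_eq3 (x : int) : (clip x == 3) = (x \notin window).
Proof. by rewrite /clip; case: ifP => // xw; apply: contraTF xw => /eqP ->. Qed.

Section IntegralModel.

Variables (d : nat) (p : {poly int}).
Hypothesis ph : unit_height d p.

Let f (x : int) : int := p.[x].
Let g (a : rat) : rat := (map_poly intr p).[a].
Let t := table f.

Lemma map_horner_int (x : int) : g x%:~R = (f x)%:~R.
Proof. by rewrite /g horner_map. Qed.

Lemma preper_integral (a : rat) : preper g a -> exists x : int, a = x%:~R.
Proof.
move=> pa; have [d2 sp pd _] := ph.
have [a1 | a1] := eqVneq (denq a) 1.
  by exists (numq a); rewrite -[LHS]divq_num_den a1 divr1.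
(* Denominators other than 1 grow along the orbit. *)
case: (@not_preper_of_growth _ g (fun b => denq b != 1)
         (fun b => absz (denq b)) 0 a) => // b b1.
rewrite /g (@denq_horner d) //; last by lia.
have b2 : (1 < absz (denq b))%N by have := denq_gt0 b; lia.
have lt : (absz (denq b) < absz (denq b ^+ d))%N.
  by rewrite abszX -{1}[absz _]expn1 ltn_exp2l.
by split=> //; apply: contraTneq lt => ->; rewrite -leqNgt; lia.
Qed.

Lemma window_escape (x : int) :
  x \notin window -> f x \notin window /\ (absz x < absz (f x))%N.
Proof.
rewrite !mem_window -!ltNge => x3; have : `|x| < `|f x|.
  by apply: (unit_height_expands ph); lia.
by lia.
Qed.

Lemma step_table (x : int) : x \in window -> step t x = clip (f x).
Proof.
by move=> xw; rewrite /step /t /table (nth_map 0) ?index_mem // nth_index.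
Qed.

(** [clip] semiconjugates f to [step t], since f maps no point from outside the
    window into it. *)
Lemma clip_step (x : int) : clip (f x) = step t (clip x).
Proof.
have [xw | xw] := boolP (x \in window); first by rewrite (clip_id xw) step_table.
have [fx _] := window_escape xw.
move: (fx) (xw); rewrite -!clip_eq3 => /eqP -> /eqP ->.
by rewrite /step nth_default // size_map.
Qed.

Lemma clip_iter n (x : int) : clip (iter n f x) = iter n (step t) (clip x).
Proof. by elim: n => //= n <-; apply: clip_step. Qed.

Lemma preper_trapped (x : int) : preper f x -> x \in trapped t.
Proof.
have esc k : iter k f x \notin window -> ~ preper f x.
  by apply: (@not_preper_of_growth _ f (fun y => y \notin window) absz) => y /window_escape.
move=> px; have xw : x \in window by apply/negPn/negP => /(esc 0%N)/(_ px).
rewrite mem_filter xw andbT -[x in iter _ _ x](clip_id xw) -clip_iter clip_eq3 negbK.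
by apply/negPn/negP => /esc/(_ px).
Qed.

(** The value of f at a point of L is not collapsed, since [step t] sends it to
    L, which does not contain 3. *)
Lemma step_stable (L : seq int) (x : int) :
  {subset L <= window} -> {in L, forall y, step t y \in L} -> x \in L -> f x = step t x.
Proof.
move=> Lw stL xL; have := stL x xL; rewrite step_table ?Lw // => /Lw fw.
by rewrite clip_id //; apply/negPn/negP; rewrite -clip_eq3 => /eqP e; rewrite e in fw.
Qed.

Lemma realizes_iso (phi : polymap) (s : seq (nat * nat)) :
  (forall a, action phi (affine_pt a) = affine_pt (g a)) ->
  realizes t s -> digraph_iso (portrait phi) (digraph_of s).
Proof.
move=> act /hasP[L LP /andP[/allP stL /eqP <-]].
have Lt : L =i trapped t by apply: perm_mem; rewrite -mem_permutations.
have Lw : {subset L <= window} by move=> x; rewrite Lt mem_filter => /andP[].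
have uL : uniq L.
  rewrite (perm_uniq (_ : perm_eq L (trapped t))) -?mem_permutations //.
  exact: filter_uniq.
have fE x : x \in L -> f x = step t x := step_stable Lw stL.
have fL : {in L, forall x, f x \in L} by move=> x xL; rewrite fE ?stL.
have -> : arrows (step t) L = arrows f L.
  apply/eq_in_map => i; rewrite mem_iota => /= iL; rewrite fE //; exact: mem_nth.
apply: digraph_iso_list => // [x | a]; first by rewrite act map_horner_int.
have prepE b : preperiodic phi (affine_pt b) <-> preper g b.
  exact: (preper_inj _ affine_pt_inj act).
rewrite prepE; split=> [pa | [x xL ->]].
  have [x xE] := preper_integral pa; exists x => //; rewrite Lt.
  by apply: preper_trapped; apply/(preper_inj _ (@intr_inj rat) map_horner_int); rewrite -xE.
apply/(preper_inj _ (@intr_inj rat) map_horner_int).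
exact: preper_of_stable xL.
Qed.

Lemma trapped_neq_nil (phi : polymap) :
  (forall a, action phi (affine_pt a) = affine_pt (g a)) ->
  inhabited (vertex (portrait phi)) -> trapped t != [::].
Proof.
move=> act [[a pa]].
have pg : preper g a by apply/(preper_inj _ affine_pt_inj act).
have [x xE] := preper_integral pg.
have : x \in trapped t.
  by apply: preper_trapped; apply/(preper_inj _ (@intr_inj rat) map_horner_int); rewrite -xE.
by case: trapped.
Qed.

End IntegralModel.

(** * Classification of the tables *)

(** If t has trapped points, they form one of the 14 portraits under [step t]. *)
Definition classified (t : seq int) : bool :=
  (trapped t != [::]) ==> has (realizes t) portraits.

(** Tables in which neither 2 nor -2 stays in the window. *)
Lemma classified_generic (a b c : int) :
  a \in rcons window 3 -> b \in [:: -1; 0; 1] -> c \in rcons window 3 ->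
  [|| a == 3, c == 3 | (2 %| a - c)%Z] -> classified [:: 3; a; b; c; 3].
Proof.
have /allP chk : all (fun a => all (fun b => all (fun c =>
    [|| a == 3, c == 3 | (2 %| a - c)%Z] ==> classified [:: 3; a; b; c; 3])
  (rcons window 3)) [:: -1; 0; 1]) (rcons window 3) by vm_compute.
by move=> /chk/allP ca /ca/allP cb /cb/implyP.
Qed.

(** The table of [extremal_value s e d] for s = 1 or -1, e = 0 or 1 and d >= 2:
    the value at -2 is outside the window, and the value at -1 is s ((-1)^d - (d mod 2) + e), where
    (-1)^d = 1 - 2 (d mod 2). *)
Definition extremal_table (s e : int) (d : nat) : seq int :=
  [:: 3; clip (s * (1 - 3 * (odd d)%:Z + e)); clip (s * (e - 1));
      clip (s * (1 - d%:Z + e)); clip (s * (1 + e))].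

(** The table of x -> - f (- x) in terms of the table of f. *)
Definition mirror (t : seq int) : seq int := rev [seq clip (- x) | x <- t].

(** For d >= 5 the value at 1 is outside the window, so the table depends on d
    only through its parity. *)
Lemma classified_extremal (s e : int) (d : nat) :
  s \in [:: 1; -1] -> e \in [:: 0; 1] -> (2 <= d)%N ->
  classified (extremal_table s e d) && classified (mirror (extremal_table s e d)).
Proof.
have /allP chk : all (fun s => all (fun e => all (fun d =>
    classified (extremal_table s e d) && classified (mirror (extremal_table s e d)))
  (iota 2 5)) [:: 0; 1]) [:: 1; -1] by vm_compute.
move=> sE eE d2; have {chk}/allP chk := allP (chk s sE) e eE.
have [d6 | d7] := ltnP d 7; first by apply: chk; rewrite mem_iota d2.
suff -> : extremal_table s e d = extremal_table s e (if odd d then 5 else 6).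
  by apply: chk; case: ifP.
have far k : (5 <= k)%N -> clip (s * (1 - k%:Z + e)) = 3.
  move=> k5; rewrite /clip ifF //; apply/negbTE; rewrite mem_window.
  by move: sE eE; rewrite !inE => /orP[] /eqP -> /orP[] /eqP ->; lia.
by rewrite /extremal_table (far d) 1?far; case: (odd d) => //; lia.
Qed.

Lemma table_extremal (d : nat) (p : {poly int}) :
  unit_height d p -> `|p.[2]| <= 2 ->
  exists s e, [/\ s \in [:: 1; -1], e \in [:: 0; 1] &
    table (horner p) = extremal_table s e d].
Proof.
move=> ph p2; have [e eE pE] := unit_height_extremal ph p2.
have [d2 _ pd _] := ph; exists p`_d, e.
have sE : p`_d \in [:: 1; -1] by rewrite !inE; move: pd; lia.
split=> //; rewrite /table /= !pE /extremal_value /extremal_table.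
move: (p`_d) sE => s sE.
have e01 : e = 0 \/ e = 1 by move: eE; rewrite !inE => /orP[] /eqP; [left|right].
have s1 : s = 1 \/ s = -1 by move: sE; rewrite !inE => /orP[] /eqP; [left|right].
congr [:: _; clip (_ * _); clip (_ * _); clip (_ * _); clip (_ * _)].
- rewrite /clip ifF //; apply/negbTE; rewrite mem_window.
  have := subrX1 (- 2 : int) d; move: (\sum_(i < d) _) => T.
  have : 4 <= `|(- 2 : int) ^+ d|.
    rewrite normrX (_ : 4 = `|-2 : int| ^+ 2) //; apply: ler_weXn2l => //.
  by move: (_ ^+ d) => X; case: s1 => ->; case: e01 => ->; lia.
- have := subrX1 (- 1 : int) d; rewrite -signr_odd; move: (\sum_(i < d) _) => T.
  by case: (odd d) => /=; rewrite ?expr0 ?expr1; lia.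
- case: d d2 {ph p2 pE pd} => // n _.
  rewrite big_ord_recl big1 ?exprS ?mul0r ?expr0; first by lia.
  by move=> i _; rewrite lift0 exprS mul0r.
- under eq_bigr do rewrite expr1n.
  by rewrite sumr_const card_ord expr1n natz; lia.
- have := subrX1 (2 : int) d; move: (\sum_(i < d) _) (_ ^+ d) => T X; lia.
Qed.

(** The polynomial - p(-X), conjugate of p by x -> -x. *)
Definition conj_opp (d : nat) (p : {poly int}) : {poly int} :=
  \poly_(i < d.+1) ((-1) ^+ i.+1 * p`_i).

Lemma horner_conj_opp (d : nat) (p : {poly int}) (x : int) :
  (size p <= d.+1)%N -> (conj_opp d p).[x] = - p.[- x].
Proof.
move=> sp; rewrite horner_poly (horner_coef_wide _ sp) -sumrN.
by apply: eq_bigr => i _; rewrite exprS [in RHS]exprNn; ring.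
Qed.

Lemma unit_height_conj_opp (d : nat) (p : {poly int}) :
  unit_height d p -> unit_height d (conj_opp d p).
Proof.
case=> d2 sp pd p1; split=> // [||i]; rewrite ?size_poly ?coef_poly ?ltnSn //.
  by rewrite normrM normrX normrN1 expr1n mul1r.
by case: ifP => _; rewrite ?normr0 // normrM normrX normrN1 expr1n mul1r.
Qed.

Lemma clip_oppK (x : int) : clip (- clip (- x)) = clip x.
Proof.
rewrite {2}/clip mem_window normrN -mem_window {2}/clip.
by case: ifP => xw; rewrite ?opprK // /clip xw.
Qed.

Lemma table_conj_opp (d : nat) (p : {poly int}) :
  (size p <= d.+1)%N -> table (horner p) = mirror (table (horner (conj_opp d p))).
Proof.
by move=> sp; rewrite /mirror /table /= /rev /= !(horner_conj_opp _ sp) !clip_oppK !opprK.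
Qed.

Lemma classified_unit_height (d : nat) (p : {poly int}) :
  unit_height d p -> classified (table (horner p)).
Proof.
move=> ph; have [d2 sp pd p1] := ph.
have [p2 | p2] := leP `|p.[2]| 2.
  have [s [e [sE eE ->]]] := table_extremal ph p2.
  by have /andP[] := classified_extremal sE eE d2.
have [pm2 | pm2] := leP `|p.[-2]| 2.
  have q2 : `|(conj_opp d p).[2]| <= 2 by rewrite (horner_conj_opp _ sp) normrN.
  have [s [e [sE eE tE]]] := table_extremal (unit_height_conj_opp ph) q2.
  by rewrite (table_conj_opp sp) tE; have /andP[] := classified_extremal sE eE d2.
have clip3 x : 2 < `|x| -> clip x = 3.
  by move=> x2; rewrite /clip mem_window leNgt x2.
have clip_in x : clip x \in rcons window 3.
  by rewrite mem_rcons inE /clip; case: ifP => // ->; rewrite orbT.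
rewrite /table /= (clip3 _ p2) (clip3 _ pm2); apply: classified_generic => //.
  rewrite horner_coef0; move: (p1 0%N); move: (p`_0) => y y1.
  have yw : y \in window by rewrite mem_window; lia.
  by rewrite (clip_id yw) !inE; lia.
have [// | w1] := eqVneq (clip p.[-1]) 3; have [// | w2] := eqVneq (clip p.[1]) 3.
move: w1 w2; rewrite /= !clip_eq3 !negbK => w1 w2.
by rewrite !clip_id // horner_parity.
Qed.

(** * Polynomial maps of height 0 *)

Lemma action_affine_poly (phi : polymap) (p : {poly int}) :
  (size p <= (deg phi).+1)%N ->
  (forall j : 'I_(deg phi).+1, coef phi ord0 j = (p`_(deg phi - j))%:~R) ->
  forall a, action phi (affine_pt a) = affine_pt (map_poly intr p).[a].
Proof.
move=> sp cE a; rewrite action_affine; congr affine_pt.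
rewrite (@horner_coef_wide _ (deg phi).+1) ?size_map_inj_poly //; last exact: intr_inj.
rewrite (reindex_inj rev_ord_inj) /=; apply: eq_bigr => j _.
by rewrite cE /= coef_map_id0 // subSS subKn // -ltnS.
Qed.

(** Primitive coordinates w of (a_0 : ... : a_d : 1) have entries in {-1, 0, 1},
    and the last one, k, is nonzero; hence k = 1 or -1 and a_j = k w_j. *)
Lemma height0_coef (R : realType) (phi : polymap) :
  height R phi = 0 ->
  exists2 z : 'I_(deg phi).+1 -> int,
    forall j, `|z j| <= 1 & forall j, coef phi ord0 j = (z j)%:~R.
Proof.
rewrite /height /log_height; set P := pt _ => h0.
have [l l0 xE] := (eq_pt (coords_neq0 P) (coef1_neq0 phi)).1 (pt_coords P).
move: (coords P) xE h0 => x xE h0.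
set w := primitive_coords x in h0.
have w1 i : (absz (w ord0 i) <= 1)%N.
  rewrite leqNgt; apply/negP => w2; have : (1 < \max_i absz (w ord0 i))%N.
    by apply: leq_trans w2 _; apply: leq_bigmax.
  by rewrite -(ltr_nat R) => /ln_gt0; rewrite h0 ltxx.
pose D := (\prod_j denq (x ord0 j))%:~R * l.
have D0 : D != 0.
  by rewrite mulf_neq0 // intr_eq0; apply/prodf_neq0 => j _; rewrite denq_neq0.
have wE i :
    D * Defs.coef1 phi ord0 i = (w ord0 i)%:~R * (content (integral_coords x))%:~R.
  have xi : x ord0 i = l * Defs.coef1 phi ord0 i by rewrite {1}xE mxE.
  have /rowP/(_ i) := integral_coordsE x; rewrite [LHS]mxE [RHS]mxE xi mulrA => <-.
  by rewrite -intrM [w _ _]mxE divzK //; apply: content_dvd.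
move: (content _) wE => c wE.
pose k := w ord0 (rshift (deg phi).+1 (ord0 : 'I_1)).
have kE : D = k%:~R * c%:~R.
  rewrite -wE (_ : Defs.coef1 phi _ _ = 1) ?mulr1 //.
  by apply: etrans (row_mxEr (coef phi) 1%:M ord0 ord0) _; rewrite mxE.
have k1 : k = 1 \/ k = -1.
  have : k != 0 by apply: contraNneq D0 => k0; rewrite kE k0 mul0r.
  by move: (w1 (rshift (deg phi).+1 (ord0 : 'I_1))); rewrite -/k; lia.
exists (fun j : 'I_(deg phi).+1 => k * w ord0 (lshift 1 j)) => j.
  by move: (w1 (lshift 1 j)); case: k1 => ->; lia.
rewrite -(row_mxEl (coef phi) (1%:M : 'M_1) ord0 j).
apply: (mulfI D0); rewrite [LHS]wE rmorphM kE /= mulrACA -(intrM _ k k).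
have -> : k * k = 1 by case: k1 => ->.
by rewrite mul1r mulrC.
Qed.

(** Otherwise (1 : 0) would be a common zero of the two forms. *)
Lemma lead_coef_neq0 (phi : polymap) : coef phi ord0 ord0 != 0.
Proof.
have d2 := deg_ge2 phi; apply/eqP => a0.
have [] := @no_common_zero phi 1 0.
- rewrite /Defs.form big_ord_recl /= mxE a0 rmorph0 !mul0r add0r big1 // => i _.
  by rewrite expr0n mulr0.
- by rewrite expr0n; case: (deg phi) d2.
by move/eqP; rewrite oner_eq0.
Qed.

Lemma height0_poly (R : realType) (phi : polymap) :
  height R phi = 0 ->
  exists2 p : {poly int}, unit_height (deg phi) p &
    forall a, action phi (affine_pt a) = affine_pt (map_poly intr p).[a].
Proof.
case/height0_coef => z z1 zE; pose d := deg phi.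
pose p : {poly int} := \poly_(i < d.+1) z (inord (d - i)).
have pE (j : 'I_d.+1) : p`_(d - j) = z j.
  by rewrite coef_poly ltnS leq_subr subKn ?inord_val // -ltnS.
exists p; last by apply: action_affine_poly => [|j]; rewrite ?size_poly // pE zE.
split=> [||| i]; rewrite ?size_poly ?deg_ge2 //.
  have -> : p`_(deg phi) = z ord0 by rewrite -(pE ord0) subn0.
  have := lead_coef_neq0 phi; rewrite zE intr_eq0.
  by move: (z1 ord0); lia.
by rewrite coef_poly; case: ifP => _; rewrite ?normr0.
Qed.

Lemma poly_polymap (R : realType) (d : nat) (p : {poly int}) :
  unit_height d p ->
  exists2 phi : polymap, height R phi = 0 &
    forall a, action phi (affine_pt a) = affine_pt (map_poly intr p).[a].
Proof.
move=> [d2 sp pd p1].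
pose c : 'rV[int]_d.+1 := \row_j p`_(d - j).
have ncz (x0 x1 : algC) : Defs.form (map_mx ratr (map_mx intr c)) x0 x1 = 0 ->
    x1 ^+ d = 0 -> x0 = 0 /\ x1 = 0.
  move=> f0 /eqP; rewrite expf_eq0 => /andP[_ /eqP x10]; split=> //.
  move: f0; rewrite x10 /Defs.form big_ord_recl big1 => [|i _]; last first.
    by rewrite lift0 exprS mul0r mulr0.
  rewrite !mxE /= expr0 mulr1 addr0 subn0 => /eqP; rewrite mulf_eq0 expf_eq0.
  rewrite fmorph_eq0 intr_eq0 => /orP[/eqP p0|/andP[_ /eqP] //].
  by move: pd; rewrite p0.
pose phi := @Polymap d d2 (map_mx intr c) ncz; exists phi; last first.
  by apply: action_affine_poly => // j; rewrite !mxE.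
pose z : 'rV[int]_(d + 1).+1 := row_mx c 1%:M.
have zE : map_mx intr z = Defs.coef1 phi by rewrite (map_row_mx _ c) map_scalar_mx.
have z0 : map_mx intr z != 0 :> 'rV[rat]_(d + 1).+1.
  by rewrite zE; exact: (coef1_neq0 phi).
have zlast : z ord0 (rshift d.+1 (ord0 : 'I_1)) = 1.
  by apply: etrans (row_mxEr c 1%:M ord0 ord0) _; rewrite mxE.
have z1 i : (absz (z ord0 i) <= 1)%N.
  rewrite /z mxE; case: split => j; rewrite mxE; last by case: eqP.
  by move: (p1 (d - j)%N); lia.
have -> : height R phi = log_height R (pt z0).
  by congr log_height; apply/eq_pt; exists 1; rewrite ?oner_eq0 // scale1r zE.
rewrite log_height_coprime.
  rewrite (_ : \max_i _ = 1%N) ?ln1 //; apply/eqP; rewrite eqn_leq; apply/andP; split.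
    by apply/bigmax_leqP.
  by rewrite (bigD1 (rshift d.+1 (ord0 : 'I_1))) //= zlast leq_maxl.
by apply/eqP; rewrite -dvdn1; have := content_dvd z (rshift d.+1 (ord0 : 'I_1)); rewrite zlast.
Qed.

(** * The 14 portraits *)

(** Coefficients, constant term first, of polynomials realizing the 14
    portraits, in the order of [portraits]. *)
Definition models : seq (seq int) :=
  [:: [:: 0; 1; 0; 1]; [:: 0; 1; 1; 1]; [:: 0; 1; 1]; [:: 1; 0; 0; -1];
      [:: 0; 0; 0; 1]; [:: 0; 0; 0; -1]; [:: 0; 0; 1]; [:: 1; 0; -1; 0; -1];
      [:: 1; 0; -1]; [:: 0; 1; 0; -1]; [:: 0; -1; 1]; [:: 0; -1; 1; 1];
      [:: 1; 1; 1; -1]; [:: 1; -1; -1]].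

Lemma unit_height_models (z : seq int) :
  z \in models -> unit_height (size z).-1 (Poly z).
Proof.
move=> zm; have : [&& (2 < size z)%N, `|last 0 z| == 1 & all (fun c => `|c| <= 1) z].
  by move: z zm; apply/allP; vm_compute.
case/and3P=> z2 /eqP zl /allP z1; split=> [|||i].
- by case: (size z) z2.
- by rewrite prednK ?size_Poly //; lia.
- by rewrite coef_Poly nth_last.
rewrite coef_Poly; have [iz | iz] := ltnP i (size z); first exact/z1/mem_nth.
by rewrite nth_default.
Qed.

Lemma models_realize (s : seq (nat * nat)) :
  s \in portraits -> exists2 z, z \in models & realizes (table (horner (Poly z))) s.
Proof.
(* Evaluation is done on the lists of coefficients, where it computes. *)
move=> sp; have : has (fun z => realizes (table (horner_rec z)) s) models.
  by move: s sp; apply/allP; vm_compute.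
case/hasP => z zm zs; exists z => //; rewrite (_ : table _ = table (horner_rec z)) //.
by apply: eq_map => x; rewrite horner_Poly.
Qed.

(* The portrait is assumed to have a vertex: a polynomial map of height 0 such
   as x^2 + 1 has no rational preperiodic point besides infinity. *)
Theorem theorem1p5 (R : realType) :
  (forall phi : polymap,
     height R phi = 0 ->
     inhabited (vertex (portrait phi)) ->
     exists s : seq (nat * nat),
       s \in portraits /\ digraph_iso (portrait phi) (digraph_of s)) /\
  (forall s : seq (nat * nat),
     s \in portraits ->
     exists phi : polymap,
       height R phi = 0 /\ digraph_iso (portrait phi) (digraph_of s)).
Proof.
split=> [phi /height0_poly[p ph act] nonempty | s /models_realize[z zm zs]].
  have := classified_unit_height ph.
  rewrite /classified (trapped_neq_nil ph act nonempty) => /hasP[s sp ps].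
  by exists s; split; [exact: sp | exact: (realizes_iso ph act ps)].
have zh := unit_height_models zm.
have [phi h0 act] := poly_polymap R zh.
by exists phi; split; [exact: h0 | exact: (realizes_iso zh act zs)].
Qed.
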